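(* Let $d\ge 1$ be a positive integer. Then there exists an infinite class of (pairwise non-isomorphic) graphs $G$ such that $$\rho^{\operatorname{Dist}(G)}(G)=d=\rho^{\operatorname{Fix}(G)+1}(G).$$
   Context: All graphs are finite and simple. A coloring of the vertices of a graph $G$ with $m$ colors (a map from $V(G)$ to a set of $m$ colors, not required to use every color) is $m$-distinguishing if the only automorphism of $G$ preserving the color classes (i.e. mapping each color class to itself) is the trivial one. The distinguishing number $\operatorname{Dist}(G)$ is the smallest $m$ for which $G$ has an $m$-distinguishing coloring. For $m\ge \operatorname{Dist}(G)$, the $m$-paint cost $\rho^m(G)$ is the minimum size of the complement of a color class over all $m$-distinguishing colorings of $G$. A set $S\subseteq V(G)$ is a fixing set for $G$ if the only automorphism of $G$ that fixes every element of $S$ is the trivial one; the fixing number $\operatorname{Fix}(G)$ is the smallest cardinality of a fixing set. *)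

(* Defs.v *)
From mathcomp Require Import all_boot all_fingroup.

Set Implicit Arguments.
Unset Strict Implicit.
Unset Printing Implicit Defensive.

Record sgraph := SGraph {
  vertex :> finType;
  edge : rel vertex;
  edge_sym : symmetric edge;
  edge_irr : irreflexive edge }.

Definition isomorphic (G H : sgraph) : Prop :=
  exists2 f : G -> H, bijective f & forall x y, edge (f x) (f y) = edge x y.

Definition automorphism (G : sgraph) (s : {perm G}) : bool :=
  [forall x, forall y, edge (s x) (s y) == edge x y].

Definition color_class (G : sgraph) m (c : {ffun G -> 'I_m}) (i : 'I_m) : {set G} :=
  [set x | c x == i].

Definition distinguishing (G : sgraph) m (c : {ffun G -> 'I_m}) : bool :=
  [forall s : {perm G},
    automorphism s && [forall i, s @: color_class c i == color_class c i]
    ==> (s == 1%g)].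

Lemma distinguishing_exists (G : sgraph) :
  exists m, [exists c : {ffun G -> 'I_m}, distinguishing c].
Proof.
exists #|G|; apply/existsP; exists [ffun x => enum_rank x].
apply/forallP => s; apply/implyP => /andP[_ /forallP hs].
apply/eqP/permP => x; rewrite perm1.
have: s x \in color_class [ffun x => enum_rank x] (enum_rank x).
  by rewrite -(eqP (hs (enum_rank x))); apply: imset_f; rewrite inE ffunE.
by rewrite inE ffunE => /eqP/enum_rank_inj.
Qed.

Definition Dist (G : sgraph) : nat := ex_minn (distinguishing_exists G).

(* The default value #|G| bounds every complement from above, so it does not
   affect the minimum when m >= Dist; it is a junk value when m < Dist. *)
Definition paint_cost (G : sgraph) (m : nat) : nat :=
  \big[minn/#|G|]_(c : {ffun G -> 'I_m} | distinguishing c)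
    \big[minn/#|G|]_(i < m) #|~: color_class c i|.

Definition fixing (G : sgraph) (S : {set G}) : bool :=
  [forall s : {perm G},
    automorphism s && [forall x in S, s x == x] ==> (s == 1%g)].

Lemma fixing_exists (G : sgraph) :
  exists k, [exists S : {set G}, fixing S && (#|S| == k)].
Proof.
exists #|[set: G]|; apply/existsP; exists [set: G]; rewrite eqxx andbT.
apply/forallP => s; apply/implyP => /andP[_ /forall_inP hs].
by apply/eqP/permP => x; rewrite perm1; apply/eqP/hs; rewrite inE.
Qed.

Definition Fix (G : sgraph) : nat := ex_minn (fixing_exists G).

(* Main.v *)
Require Import Defs.
From mathcomp Require Import all_boot all_fingroup.
From mathcomp Require Import zify.

Set Implicit Arguments.
Unset Strict Implicit.
Unset Printing Implicit Defensive.

(** The complement of a class of a distinguishing coloring is a fixing set, and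
    giving the elements of a fixing set [S] pairwise distinct colors leaves one
    further class, with complement [S]. Hence rho^(Fix + 1) = Fix and
    Dist <= Fix + 1 for every graph, and it is enough to find graphs with
    Fix <= d < Dist. We take threshold graphs with weights 0, ..., 2n, in which
    the weight n is given to d + 1 vertices and every other weight to one:
    permutations of the d + 1 twins are automorphisms, so d colors do not
    suffice, while degrees increase with weights, so that fixing d of the twins
    fixes every vertex. *)

Lemma bigminn_ge (I : finType) (P : pred I) (F : I -> nat) a k :
  k <= a -> (forall i, P i -> k <= F i) -> k <= \big[minn/a]_(i | P i) F i.
Proof.
move=> ka kF; elim/big_ind: _ => // x y kx ky.
by rewrite leq_min kx ky.
Qed.

Lemma bigminn_le (I : finType) (P : pred I) (F : I -> nat) a j :
  P j -> \big[minn/a]_(i | P i) F i <= F j.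
Proof.
move=> Pj; have: j \in index_enum I by rewrite mem_index_enum.
elim: (index_enum I) => [|i r IH] //; rewrite inE big_cons.
case/predU1P => [<-|/IH {}IH]; first by rewrite Pj geq_minl.
by case: ifP => // _; rewrite geq_min IH orbT.
Qed.

Lemma color_classes_stableP (G : sgraph) m (c : {ffun G -> 'I_m}) (s : {perm G}) :
  reflect (forall x, c (s x) = c x)
    [forall i, s @: color_class c i == color_class c i].
Proof.
apply: (iffP forallP) => [h x|h i].
  have: s x \in color_class c (c x).
    by rewrite -(eqP (h (c x))); apply: imset_f; rewrite inE.
  by rewrite inE => /eqP.
rewrite eqEcard card_imset ?leqnn ?andbT; last exact: perm_inj.
by apply/subsetP => y /imsetP[x]; rewrite !inE => cx ->; rewrite h.
Qed.

Lemma fixing_Fix (G : sgraph) : exists2 S : {set G}, fixing S & #|S| = Fix G.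
Proof.
rewrite /Fix; case: ex_minnP => k /existsP[S /andP[fS /eqP cS]] _.
by exists S.
Qed.

Lemma Fix_le (G : sgraph) (S : {set G}) : fixing S -> Fix G <= #|S|.
Proof.
move=> fS; rewrite /Fix; case: ex_minnP => k _; apply.
by apply/existsP; exists S; rewrite fS eqxx.
Qed.

(** An automorphism that fixes every vertex outside class [i] cannot move a vertex out of that
    class: the image would be fixed too, against injectivity. So it preserves all the classes. *)
Lemma fixing_setC_color_class (G : sgraph) m (c : {ffun G -> 'I_m}) i :
  distinguishing c -> fixing (~: color_class c i).
Proof.
move=> /forallP dc; apply/forallP => s; apply/implyP => /andP[aut_s /forall_inP fs].
apply: (implyP (dc s)); rewrite aut_s; apply/color_classes_stableP => x.
have [/eqP cx|ncx] := boolP (c x == i); last first.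
  by rewrite (eqP (fs x _)) // !inE.
have [/eqP csx|ncsx] := boolP (c (s x) == i); first by rewrite csx cx.
have /eqP/perm_inj sx : s (s x) == s x by apply: fs; rewrite !inE.
by rewrite sx.
Qed.

Lemma Fix_le_paint_cost (G : sgraph) m : Fix G <= paint_cost G m.
Proof.
(* [#|G|] is the default value of both minima, so it needs the bound as well. *)
have FixT : Fix G <= #|G|.
  by have [S _ <-] := fixing_Fix G; exact: max_card.
apply: bigminn_ge => // c dc; apply: bigminn_ge => // i _.
exact/Fix_le/fixing_setC_color_class.
Qed.

Lemma distinguishing_of_fixing (G : sgraph) (S : {set G}) : fixing S ->
  exists2 c : {ffun G -> 'I_#|S|.+1},
    distinguishing c & ~: color_class c ord0 = S.
Proof.
move=> /forallP fS.
(* Color 0 marks the complement of [S], hence the shift of the indices by one. *)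
pose col x := if x \in S then (index x (enum S)).+1 else 0.
have col_lt x : col x < #|S|.+1.
  by rewrite /col; case: ifP => // xS; rewrite ltnS cardE index_mem mem_enum.
exists [ffun x => Ordinal (col_lt x)]; last first.
  apply/setP => x; rewrite !inE ffunE -val_eqE /= /col.
  by case: (x \in S).
apply/forallP => s; apply/implyP => /andP[aut_s /color_classes_stableP cs].
apply: (implyP (fS s)); rewrite aut_s; apply/forall_inP => x xS.
have /(congr1 val) := cs x; rewrite !ffunE /= /col xS; case: ifP => // sxS [] eq_ix.
by apply/eqP; apply: (index_inj x _ _ eq_ix); rewrite mem_enum.
Qed.

Lemma paint_cost_Fix (G : sgraph) : paint_cost G (Fix G).+1 = Fix G.
Proof.
apply/eqP; rewrite eqn_leq Fix_le_paint_cost andbT.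
have [S fS <-] := fixing_Fix G; have [c dc cS] := distinguishing_of_fixing fS.
rewrite -[leqRHS](congr1 (fun A : {set G} => #|A|) cS).
apply: leq_trans (_ : \big[minn/#|G|]_(i < #|S|.+1) #|~: color_class c i| <= _).
  exact: (bigminn_le (P := @distinguishing G _)).
exact: bigminn_le.
Qed.

Lemma Dist_le_Fix (G : sgraph) : Dist G <= (Fix G).+1.
Proof.
have [S fS <-] := fixing_Fix G; have [c dc _] := distinguishing_of_fixing fS.
by rewrite /Dist; case: ex_minnP => k _; apply; apply/existsP; exists c.
Qed.

Section ThresholdGraph.
Variables (V : finType) (w : V -> nat) (t : nat).

Definition threshold_edge : rel V := fun x y => (x != y) && (t <= w x + w y).

Lemma threshold_edge_sym : symmetric threshold_edge.
Proof. by move=> x y; rewrite /threshold_edge eq_sym addnC. Qed.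

Lemma threshold_edge_irr : irreflexive threshold_edge.
Proof. by move=> x; rewrite /threshold_edge eqxx. Qed.

Definition threshold_graph := SGraph threshold_edge_sym threshold_edge_irr.

Lemma threshold_automorphism (s : {perm threshold_graph}) :
  (forall x, w (s x) = w x) -> automorphism s.
Proof.
move=> ws; apply/forallP => x; apply/forallP => y.
by rewrite /edge /= /threshold_edge !ws (inj_eq perm_inj).
Qed.

(** With at most [k] colors, two of the [k.+1] vertices of equal weight share a color, and swapping
    them is a nontrivial automorphism preserving the coloring. *)
Lemma threshold_Dist_gt (k : nat) (f : 'I_k.+1 -> V) :
  injective f -> (forall i j, w (f i) = w (f j)) -> k < Dist threshold_graph.
Proof.
move=> f_inj wf; rewrite /Dist.
case: ex_minnP => m /existsP[c /forallP dc] _; rewrite ltnNge; apply/negP => mk.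
have /injectivePn[i [j ij cij]] : ~~ injectiveb (fun i => c (f i)).
  apply/negP => /injectiveP/leq_card; rewrite !card_ord.
  by rewrite leqNgt ltnS mk.
have /eqP/permP/(_ (f i)) : tperm (f i : threshold_graph) (f j) == 1%g.
  apply: (implyP (dc _)); apply/andP; split.
    by apply: threshold_automorphism => x; case: tpermP => // ->.
  by apply/color_classes_stableP => x; case: tpermP => // ->.
by rewrite tpermL perm1 => /f_inj ji; rewrite ji eqxx in ij.
Qed.

(** Apart from [x] and [y], the two neighborhoods are nested by weight, and [z] makes the inclusion
    strict; a possible edge between [x] and [y] counts equally for both. *)
Lemma card_neighbors_lt (x y z : V) :
  w x < w y -> z != x -> z != y -> w x + w z < t <= w y + w z ->
  #|[set u | threshold_edge x u]| < #|[set u | threshold_edge y u]|.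
Proof.
move=> xy zx zy /andP[xz yz].
have neq_xy : x != y by apply: contraTneq xy => ->; rewrite ltnn.
rewrite (cardsD1 y) [ltnRHS](cardsD1 x) !inE threshold_edge_sym ltn_add2l.
apply/proper_card/properP; split.
  apply/subsetP => u; rewrite !inE /threshold_edge => /and3P[uy xu txu].
  by rewrite !(eq_sym _ u) uy (eq_sym u) xu (leq_trans txu) // leq_add2r ltnW.
exists z; rewrite !inE /threshold_edge.
  by rewrite zx eq_sym zy yz.
by rewrite (leqNgt t) xz !andbF.
Qed.

End ThresholdGraph.

Lemma card_neighbors_aut (G : sgraph) (s : {perm G}) x : automorphism s ->
  #|[set u | edge (s x) u]| = #|[set u | edge x u]|.
Proof.
move=> /forallP aut_s; rewrite -(card_imset [set u | edge x u] (@perm_inj _ s)).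
apply: eq_card => u; rewrite -[u](permKV s) mem_imset ?inE; last exact: perm_inj.
by rewrite (eqP (forallP (aut_s x) _)).
Qed.

Section TwinGraph.
Variables (d n : nat).

(* The vertices n, ..., n + d get weight n; this uses truncated subtraction. *)
Definition twin_weight (x : 'I_(n + n + d).+1) : nat := minn x n + (x - (n + d)).

Definition twin_graph := threshold_graph twin_weight (n + n).

Lemma twin_graph_Dist_gt : d < Dist twin_graph.
Proof.
have lt_nk (k : 'I_d.+1) : n + k < (n + n + d).+1 by have := ltn_ord k; lia.
apply: (@threshold_Dist_gt _ _ _ d (fun k => Ordinal (lt_nk k))).
  by move=> i j [/eqP]; rewrite eqn_add2l => /eqP/val_inj.
by move=> i j; rewrite /twin_weight /=; have := ltn_ord i; have := ltn_ord j; lia.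
Qed.

Hypothesis d_gt0 : 0 < d.

Lemma twin_card_neighbors_lt (x y : twin_graph) :
  twin_weight x < twin_weight y ->
  #|[set u | edge x u]| < #|[set u | edge y u]|.
Proof.
move=> xy; have ltx := ltn_ord x; have lty := ltn_ord y.
suff [z [zlt zx zy zt]] : exists z, [/\ z < (n + n + d).+1, z <> x, z <> y &
    twin_weight x + (minn z n + (z - (n + d))) < n + n
      <= twin_weight y + (minn z n + (z - (n + d)))].
  apply: (@card_neighbors_lt _ twin_weight _ x y (Ordinal zlt)) => //.
    by apply/eqP => /(congr1 val).
  by apply/eqP => /(congr1 val).
move: xy; rewrite /twin_weight => xy.
(* The weight 2n - w y separates x from y; a twin replaces it when it would
   be the weight of x, or of y. *)
have [e|ne] := eqVneq (twin_weight x + twin_weight y) (n + n).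
  by exists n; rewrite /twin_weight in e; split; lia.
rewrite /twin_weight in ne.
(* A weight above [n] belongs to the vertex whose index exceeds it by [d]. *)
have [lt_yn|] := ltnP y n; first by exists (n + n - y + d); split; lia.
have [lt_nd _|le_yn le_ny] := ltnP (n + d) y.
  by exists (n + n + d - y); split; lia.
(* Here [y] is a twin, and a second twin exists because [d] is positive. *)
by have [eyn|neyn] := eqVneq (y : nat) n; [exists n.+1|exists n]; split; lia.
Qed.

(** Automorphisms preserve degrees, and degrees are strictly increasing in the weight. *)
Lemma twin_weight_aut (s : {perm twin_graph}) x :
  automorphism s -> twin_weight (s x) = twin_weight x.
Proof.
move=> /(@card_neighbors_aut _ s x) eqN.
by case: (ltngtP (twin_weight (s x)) (twin_weight x)) =>
  // /twin_card_neighbors_lt; rewrite eqN ltnn.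
Qed.

Lemma twin_graph_Fix_le : Fix twin_graph <= d.
Proof.
(* These are all the twins except the last one, [n + d]. *)
pose S : {set twin_graph} := [set (inord (n + k) : 'I_(n + n + d).+1) | k : 'I_d].
have memS (x : twin_graph) : n <= x < n + d -> x \in S.
  move=> /andP[nx xd]; have lt_k : x - n < d by lia.
  apply/imsetP; exists (Ordinal lt_k) => //; apply: val_inj.
  by rewrite /= subnKC // inord_val.
apply: (@leq_trans #|S|); last first.
  by rewrite -[leqRHS]card_ord; apply: leq_imset_card.
apply/Fix_le/forallP => s; apply/implyP => /andP[aut_s /forall_inP fs].
apply/eqP/permP => x; rewrite perm1.
have [/fs/eqP//|xS] := boolP (x \in S).
(* If [s x] lies in [S], then [s] fixes it, and injectivity gives [s x = x]. *)
have [/fs/eqP/perm_inj//|sxS] := boolP (s x \in S).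
(* Outside [S] every weight occurs only once. *)
have := twin_weight_aut x aut_s; rewrite /twin_weight => ws.
move: (contraNN (@memS x) xS) (contraNN (@memS (s x)) sxS) => nx nsx.
apply: val_inj; move: ws nx nsx; rewrite /=.
by have := ltn_ord x; have := ltn_ord (s x); lia.
Qed.

End TwinGraph.

Theorem theorem5 (d : nat) (hd : 1 <= d) :
  exists G : nat -> sgraph,
    (forall i j : nat, i <> j -> ~ isomorphic (G i) (G j)) /\
    (forall i : nat,
       paint_cost (G i) (Dist (G i)) = d /\
       d = paint_cost (G i) (Fix (G i)).+1).
Proof.
exists (twin_graph d); split=> [i j neq_ij [f f_bij _]|i].
  (* The numbers of vertices, [n + n + d + 1], differ for distinct [n]. *)
  by have := bij_eq_card f_bij; rewrite !card_ord; lia.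
(* The chain [d.+1 <= Dist <= Fix.+1 <= d.+1] collapses to equalities. *)
have FixE : Fix (twin_graph d i) = d.
  apply/eqP; rewrite eqn_leq twin_graph_Fix_le //=.
  exact: leq_trans (twin_graph_Dist_gt d i) (Dist_le_Fix _).
have DistE : Dist (twin_graph d i) = (Fix (twin_graph d i)).+1.
  by apply/eqP; rewrite eqn_leq Dist_le_Fix FixE twin_graph_Dist_gt.
by rewrite DistE paint_cost_Fix FixE.
Qed.
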